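(* Let $n\ge 3$ be odd. Consider terms built from variables, the constants $0$ and $1$, the unary operator $\neg$, and the majority operators $M_k$ for odd $k\le n$, interpreted in $\mathbb{B}=\{0,1\}$ with $\neg$ as complementation and $M_k(x_1,\dots,x_k)=1$ iff at least $\lceil k/2\rceil$ of the $x_i$ are $1$. Let $\Omega_n$ be the following axiom system (schemas, where letters stand for arbitrary terms): <ol> <li>(Commutativity) $M_n(x_1,\dots,x_i,\dots,x_j,\dots,x_n)=M_n(x_1,\dots,x_j,\dots,x_i,\dots,x_n)$ (exchange of the arguments in positions $i<j$).</li> <li>(Majority) If at least $\lceil n/2\rceil$ of the arguments $x_1,\dots,x_n$ are equal to $y$, then $M_n(x_1,\dots,x_n)=y$; if $x_j$ is the complement of $x_i$ ($i\neq j$), then $M_n(x_1,\dots,x_n)=M_{n-2}(y_1,\dots,y_{n-2})$, where $(y_1,\dots,y_{n-2})$ is $(x_1,\dots,x_n)$ with $x_i,x_j$ removed (with $M_1(y)=y$).</li> <li>(Associativity) $M_n(z_1,\dots,z_{n-2},y,M_n(z_1,\dots,z_{n-2},x,w))=M_n(z_1,\dots,z_{n-2},x,M_n(z_1,\dots,z_{n-2},y,w))$.</li> <li>(Distributivity) For each $k$ with $\lceil n/2\rceil\le k\le n-1$: $M_n(x_1,\dots,x_{n-1},M_n(y_1,\dots,y_n))=M_n\big(M_n(x_1,\dots,x_{n-1},y_1),\dots,M_n(x_1,\dots,x_{n-1},y_k),y_{k+1},\dots,y_n\big)$.</li> <li>(Inverter propagation) $\neg M_n(x_1,\dots,x_n)=M_n(\neg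 x_1,\dots,\neg x_n)$.</li> </ol> Then $\Omega_n$ is complete with respect to $(\mathbb{B},M_n,\neg,0,1)$: every identity between such terms that is valid in $\mathbb{B}$ (i.e. holds for all assignments of the variables in $\{0,1\}$) can be derived from the axioms of $\Omega_n$.
   Context: Derivations use the usual rules of equational reasoning (reflexivity, symmetry, transitivity, substitution of terms for variables, and replacement of subterms by equal terms). ''$M_n$'' in $(\mathbb{B},M_n,\neg,0,1)$ stands for all majority operators $M_i$ with $i\le n$ odd.
   Formalization: The cancellation of complementary arguments is taken as an axiom for every odd arity k with 3 ≤ k ≤ n (M_k to M_{k-2}), not only k = n, since otherwise M_3 is unconstrained for n = 7 and the claim fails; the constants 0 and 1 count as complements of each other. *)

(* Defs.v *)
From HB Require Import structures.
From mathcomp Require Import all_boot.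

Set Implicit Arguments.
Unset Strict Implicit.
Unset Printing Implicit Defensive.

(* [Maj s] is the majority operator of arity [size s] applied to [s];
   the arities are restricted by [wf] below. *)
Inductive term : Type :=
| Var of nat
| Zero
| One
| Neg of term
| Maj of seq term.

Section TermInd.
Variable P : term -> Prop.
Hypothesis P_var : forall v, P (Var v).
Hypothesis P_zero : P Zero.
Hypothesis P_one : P One.
Hypothesis P_neg : forall t, P t -> P (Neg t).
Hypothesis P_maj : forall s, foldr (fun t => and (P t)) True s -> P (Maj s).

Fixpoint term_nested_ind (t : term) : P t :=
  match t with
  | Var v => P_var v
  | Zero => P_zero
  | One => P_one
  | Neg u => P_neg (term_nested_ind u)
  | Maj s => P_maj
      ((fix loop s : foldr (fun t => and (P t)) True s :=
          if s is u :: s' then conj (term_nested_ind u) (loop s') else I) s)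
  end.
End TermInd.

Fixpoint term_encode (t : term) : GenTree.tree nat :=
  match t with
  | Var v => GenTree.Leaf v
  | Zero => GenTree.Node 0 [::]
  | One => GenTree.Node 1 [::]
  | Neg u => GenTree.Node 2 [:: term_encode u]
  | Maj s => GenTree.Node 3 (map term_encode s)
  end.

Fixpoint term_decode (g : GenTree.tree nat) : term :=
  match g with
  | GenTree.Leaf v => Var v
  | GenTree.Node 0 _ => Zero
  | GenTree.Node 1 _ => One
  | GenTree.Node 2 (u :: _) => Neg (term_decode u)
  | GenTree.Node _ s => Maj (map term_decode s)
  end.

Lemma term_encodeK : cancel term_encode term_decode.
Proof.
elim/term_nested_ind => //= [t -> // | s IHs]; congr Maj.
by elim: s IHs => //= t s IHs [-> /IHs ->].
Qed.

HB.instance Definition _ := Countable.copy term (can_type term_encodeK).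

(* The terms over the operators [M_k] with [k <= n] odd. *)
Fixpoint wf (n : nat) (t : term) : bool :=
  match t with
  | Var _ | Zero | One => true
  | Neg u => wf n u
  | Maj s => [&& odd (size s), size s <= n & all (wf n) s]
  end.

(* [uphalf k] is the ceiling of [k / 2]. *)
Fixpoint eval (v : nat -> bool) (t : term) : bool :=
  match t with
  | Var i => v i
  | Zero => false
  | One => true
  | Neg u => ~~ eval v u
  | Maj s => uphalf (size s) <= count (eval v) s
  end.

Fixpoint subst (sigma : nat -> term) (t : term) : term :=
  match t with
  | Var i => sigma i
  | Zero => Zero
  | One => One
  | Neg u => Neg (subst sigma u)
  | Maj s => Maj (map (subst sigma) s)
  end.

(* Equational logic over the terms satisfying [wf n]: every term occurring in
   a derivation, including those substituted for variables, is one of them. *)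
Inductive derivable (n : nat) (E : term -> term -> Prop) :
    term -> term -> Prop :=
| derivable_axiom s t :
    E s t -> wf n s -> wf n t -> derivable n E s t
| derivable_refl t :
    wf n t -> derivable n E t t
| derivable_sym s t :
    derivable n E s t -> derivable n E t s
| derivable_trans s t u :
    derivable n E s t -> derivable n E t u -> derivable n E s u
| derivable_subst sigma s t :
    (forall i, wf n (sigma i)) ->
    derivable n E s t -> derivable n E (subst sigma s) (subst sigma t)
| derivable_neg s t :
    derivable n E s t -> derivable n E (Neg s) (Neg t)
| derivable_maj s1 s2 s t :
    wf n (Maj (s1 ++ s :: s2)) ->
    derivable n E s t ->
    derivable n E (Maj (s1 ++ s :: s2)) (Maj (s1 ++ t :: s2)).

(* The constants are complements of each other; without this clause no axiom
   of [Omega] would mention [Zero] and [One]. *)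
Definition complementary (s t : term) : Prop :=
  [\/ t = Neg s, s = Neg t, s = Zero /\ t = One | s = One /\ t = Zero].

(* Every axiom is stated for arity [n] only, except that the cancellation of
   complementary arguments is stated for all arities up to [n]: it is the only
   link between [M_n] and the operators of smaller arity, and is iterated
   until [M_1 (y) = y] is reached. The arity there is odd by [wf]. *)
Inductive Omega (n : nat) : term -> term -> Prop :=
| Omega_commutativity s1 s2 s3 x y :
    size (s1 ++ x :: s2 ++ y :: s3) = n ->
    Omega n (Maj (s1 ++ x :: s2 ++ y :: s3)) (Maj (s1 ++ y :: s2 ++ x :: s3))
| Omega_majority xs y :
    size xs = n ->
    uphalf n <= count_mem y xs ->
    Omega n (Maj xs) y
| Omega_complement s1 s2 s3 x y :
    size (s1 ++ x :: s2 ++ y :: s3) <= n ->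
    complementary x y ->
    Omega n (Maj (s1 ++ x :: s2 ++ y :: s3)) (Maj (s1 ++ s2 ++ s3))
| Omega_unary y :
    Omega n (Maj [:: y]) y
| Omega_associativity zs x y w :
    (size zs).+2 = n ->
    Omega n (Maj (zs ++ [:: y; Maj (zs ++ [:: x; w])]))
            (Maj (zs ++ [:: x; Maj (zs ++ [:: y; w])]))
| Omega_distributivity k xs ys :
    uphalf n <= k <= n.-1 ->
    (size xs).+1 = n ->
    size ys = n ->
    Omega n (Maj (rcons xs (Maj ys)))
            (Maj ([seq Maj (rcons xs y) | y <- take k ys] ++ drop k ys))
| Omega_inverter xs :
    size xs = n ->
    Omega n (Neg (Maj xs)) (Maj (map Neg xs)).

(* Main.v *)
Require Import Defs.
From mathcomp Require Import all_boot zify.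

(* Cancelling complementary pairs identifies M_k with M_n padded by pairs 0, 1;
   in particular a /\ b = M_3(a, b, 0) and a \/ b = M_3(a, b, 1) are available.
   Distributivity of M_n, instantiated so that the outer operator is
   conjunction with a, yields the distributivity of /\ over \/, the idempotence
   of /\, and the fact that a /\ M_k(..., y, ...) depends on y only through
   a /\ y. Together with a /\ ~ (a /\ u) = a /\ ~ u, this shows that below a
   literal x (resp. ~ x) every term may be replaced by its instance at x = 1
   (resp. x = 0). Since t = (x /\ t) \/ (~ x /\ t), a valid identity follows from
   its instances at 0 and 1, and by induction on the number of variables from
   identities between closed terms, which evaluate to constants. *)

Set Implicit Arguments.
Unset Strict Implicit.
Unset Printing Implicit Defensive.

(** * Well-formedness, congruence and cancellation *)

Lemma wf_subst n sigma t :
  (forall i, wf n (sigma i)) -> wf n t -> wf n (subst sigma t).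
Proof.
move=> wf_sigma; elim/term_nested_ind: t => //= ts IHts.
rewrite size_map => /and3P[-> -> /=].
by elim: ts IHts => //= u ts IHts [IHu /IHts{}IHts] /andP[/IHu-> /IHts].
Qed.

Lemma derivable_wf n E s t : derivable n E s t -> wf n s /\ wf n t.
Proof.
elim=> //=.
- by move=> ? ? _ [].
- by move=> ? ? ? _ [? _] _ [_ ?].
- by move=> sigma u w wf_sigma _ [wf_u wf_w]; split; apply: wf_subst.
- move=> s1 s2 u w; rewrite !size_cat !all_cat /= => wf_s _ [_ ->].
  by case/and3P: wf_s => -> -> /and3P[-> -> ->].
Qed.

Local Notation "s =[ n ]= t" := (derivable n (Omega n) s t) (at level 70).

(** One argument is replaced at a time; the prefix [s1] absorbs those already rewritten. *)
Lemma derivable_map n (T : eqType) (F G : T -> term) s1 l s2 :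
    {in l, forall x, F x =[n]= G x} -> wf n (Maj (s1 ++ map F l ++ s2)) ->
  Maj (s1 ++ map F l ++ s2) =[n]= Maj (s1 ++ map G l ++ s2).
Proof.
elim: l s1 => [|x l IHl] s1 eqFG wfF /=; first exact: derivable_refl.
have eqx : F x =[n]= G x by apply: eqFG; rewrite mem_head.
have stp := derivable_maj wfF eqx; apply: (derivable_trans stp).
have [_] := derivable_wf stp.
rewrite -/(map F l ++ s2) -!(cat_rcons (G x)); apply: IHl => y l_y.
by apply: eqFG; rewrite inE l_y orbT.
Qed.

Lemma derivable_cancel n s1 s2 x y :
    complementary x y -> wf n (Maj (s1 ++ x :: y :: s2)) ->
  Maj (s1 ++ x :: y :: s2) =[n]= Maj (s1 ++ s2).
Proof.
move=> xy wf_s; move: (wf_s) => /=; rewrite !size_cat !all_cat /=.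
case/and3P=> odd_s le_n /and4P[wf1 _ _ wf2].
apply: derivable_axiom => //.
  by apply: (@Omega_complement _ s1 [::]) => //; rewrite size_cat.
by rewrite /= !size_cat !all_cat wf1 wf2 andbT; apply/andP; split; lia.
Qed.

Lemma derivable_unary n x : 0 < n -> wf n x -> Maj [:: x] =[n]= x.
Proof.
move=> n_gt0 wf_x; apply: derivable_axiom; rewrite /= ?n_gt0 ?wf_x //.
exact: Omega_unary.
Qed.

Definition const_term (b : bool) := if b then One else Zero.

Section Algebra.
Variable n : nat.
Hypotheses (n_ge3 : 3 <= n) (n_odd : odd n).

Lemma derivable_cancel3 x y z : complementary x y ->
  wf n x -> wf n y -> wf n z -> Maj [:: x; y; z] =[n]= z.
Proof.
move=> xy wfx wfy wfz; apply: (derivable_trans (t := Maj [:: z])).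
  by apply: (@derivable_cancel n [::]); rewrite //= n_ge3 wfx wfy wfz.
by apply: derivable_unary; lia.
Qed.

Lemma derivable_cancel3r x y z : complementary y z ->
  wf n x -> wf n y -> wf n z -> Maj [:: x; y; z] =[n]= x.
Proof.
move=> yz wfx wfy wfz; apply: (derivable_trans (t := Maj [:: x])).
  by apply: (@derivable_cancel n [:: x]); rewrite //= n_ge3 wfx wfy wfz.
by apply: derivable_unary; lia.
Qed.

Lemma derivable_cancel3m x y z : complementary x z ->
  wf n x -> wf n y -> wf n z -> Maj [:: x; y; z] =[n]= y.
Proof.
move=> xz wfx wfy wfz; apply: (derivable_trans (t := Maj [:: y])).
  apply: derivable_axiom; rewrite /= ?n_ge3 ?wfx ?wfy ?wfz ?andbT //; last lia.
  exact: (@Omega_complement n [::] [:: y] [::]).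
by apply: derivable_unary; lia.
Qed.

(** [Maj [:: Neg Zero; Zero; One]] contains two complementary pairs; cancelling one or the other
    leaves either side. *)
Lemma derivable_Neg0 : Neg Zero =[n]= One.
Proof.
apply: (derivable_trans (t := Maj [:: Neg Zero; Zero; One])).
  by apply: derivable_sym; apply: derivable_cancel3r => //; apply: Or43.
by apply: derivable_cancel3 => //; apply: Or42.
Qed.

Lemma derivable_Neg1 : Neg One =[n]= Zero.
Proof.
apply: (derivable_trans (t := Maj [:: Neg One; One; Zero])).
  by apply: derivable_sym; apply: derivable_cancel3r => //; apply: Or44.
by apply: derivable_cancel3 => //; apply: Or42.
Qed.

(** The detour through [x'] serves inverter propagation: a negated padding pair is
    [Neg Zero, Neg One], which becomes complementary once [Neg Zero] is rewritten to [One]. *)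
Lemma derivable_drop_pairs j s x x' y :
    x =[n]= x' -> complementary x' y ->
    wf n (Maj (s ++ flatten (nseq j [:: x; y]))) ->
  Maj (s ++ flatten (nseq j [:: x; y])) =[n]= Maj s.
Proof.
move=> xx' x'y; elim: j => [|j IHj] /= wf_s.
  by rewrite cats0 in wf_s *; apply: derivable_refl.
have stp := derivable_maj wf_s xx'; apply: (derivable_trans stp).
have [_ wf_s'] := derivable_wf stp.
have stp' := derivable_cancel x'y wf_s'.
apply: (derivable_trans stp'); apply: IHj.
by have [] := derivable_wf stp'.
Qed.

(** * Padding to arity [n]: commutativity and inverter propagation at all arities *)

Definition fill (s : seq term) :=
  s ++ flatten (nseq (n - size s)./2 [:: Zero; One]).

Lemma size_fill s : wf n (Maj s) -> size (fill s) = n.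
Proof.
move=> /= /and3P[odd_s le_n _]; rewrite size_cat size_flatten /shape map_nseq.
by rewrite sumn_nseq /=; lia.
Qed.

Lemma wf_fill s : wf n (Maj s) -> wf n (Maj (fill s)).
Proof.
move=> wf_s /=; rewrite size_fill // n_odd leqnn all_cat.
move: wf_s => /= /and3P[_ _ ->] /=.
by apply/allP=> x /flattenP[l /nseqP[-> _]]; rewrite !inE => /pred2P[] ->.
Qed.

Lemma derivable_fill s : wf n (Maj s) -> Maj (fill s) =[n]= Maj s.
Proof.
move=> wf_s; apply: (derivable_drop_pairs (x' := Zero)); last exact: wf_fill.
  exact: derivable_refl.
exact: Or43.
Qed.

Lemma wf_full s : size s = n -> all (wf n) s -> wf n (Maj s).
Proof. by move=> sz_s wf_s; rewrite /= sz_s n_odd leqnn. Qed.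

(** Let [x] head [s2]. If [t] starts with some other [y], the induction hypothesis first rearranges
    the tail so that a single exchange of [x] and [y] yields [t]. *)
Lemma derivable_perm_full s1 s2 t :
    perm_eq s2 t -> size (s1 ++ s2) = n -> all (wf n) (s1 ++ s2) ->
  Maj (s1 ++ s2) =[n]= Maj (s1 ++ t).
Proof.
elim: s2 s1 t => [|x s2 IHs] s1 t eq_st sz_s wf_s.
  move: eq_st; rewrite perm_sym => /perm_nilP ->; apply: derivable_refl.
  exact: wf_full.
have t_x : x \in t by rewrite -(perm_mem eq_st) mem_head.
case/splitPr: t_x eq_st => a b /permP eq_s.
have stp c : perm_eq s2 c -> Maj (s1 ++ x :: s2) =[n]= Maj (s1 ++ x :: c).
  by move=> eq_sc; rewrite -!(cat_rcons x); apply: IHs; rewrite ?cat_rcons.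
case: a eq_s => [|y a] eq_s.
  by apply: stp; apply/permP=> q; have := eq_s q; rewrite /=; lia.
have eq_ay : perm_eq s2 (a ++ y :: b).
  by apply/permP=> q; have := eq_s q; rewrite /= !count_cat /=; lia.
apply: (derivable_trans (stp _ eq_ay)).
have eq_all : perm_eq (s1 ++ x :: s2) (s1 ++ x :: a ++ y :: b).
  by rewrite perm_cat2l perm_cons.
have eq_all' : perm_eq (s1 ++ x :: s2) (s1 ++ y :: a ++ x :: b).
  by rewrite perm_cat2l; apply/permP.
apply: derivable_axiom; first by apply: Omega_commutativity; rewrite -(perm_size eq_all).
  by rewrite /= -(perm_size eq_all) -(perm_all _ eq_all) sz_s n_odd leqnn.
by rewrite /= -(perm_size eq_all') -(perm_all _ eq_all') sz_s n_odd leqnn.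
Qed.

Lemma derivable_perm s t :
  perm_eq s t -> wf n (Maj s) -> Maj s =[n]= Maj t.
Proof.
move=> eq_st wf_s.
have wf_t : wf n (Maj t).
  by move: wf_s; rewrite /= (perm_size eq_st) (perm_all _ eq_st).
apply: derivable_trans (derivable_fill wf_t).
apply: derivable_trans (derivable_sym (derivable_fill wf_s)) _.
apply: (@derivable_perm_full [::]); rewrite ?size_fill //=.
  by rewrite /fill (perm_size eq_st) perm_cat2r.
by have /and3P[] := wf_fill wf_s.
Qed.

Lemma derivable_inverter s :
  wf n (Maj s) -> Neg (Maj s) =[n]= Maj (map Neg s).
Proof.
move=> wf_s.
apply: derivable_trans (derivable_neg (derivable_sym (derivable_fill wf_s))) _.
have wf_N : wf n (Maj (map Neg (fill s))).
  by move: (wf_fill wf_s); rewrite /= size_map all_map.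
apply: derivable_trans.
  apply: derivable_axiom wf_N; last exact: wf_fill.
  by apply: Omega_inverter; rewrite size_fill.
move: wf_N; rewrite map_cat map_flatten map_nseq /=.
apply: derivable_drop_pairs derivable_Neg0 _.
exact: Or41.
Qed.

(** * Conjunction, disjunction and constants *)

Definition And a b := Maj [:: a; b; Zero].
Definition Or a b := Maj [:: a; b; One].

Lemma wf_And a b : wf n a -> wf n b -> wf n (And a b).
Proof. by move=> wfa wfb; rewrite /= n_ge3 wfa wfb. Qed.

Lemma wf_Or a b : wf n a -> wf n b -> wf n (Or a b).
Proof. by move=> wfa wfb; rewrite /= n_ge3 wfa wfb. Qed.

Lemma And_congr a a' b b' :
  a =[n]= a' -> b =[n]= b' -> And a b =[n]= And a' b'.
Proof.
move=> eqa eqb; have [[wfa wfa'] [wfb wfb']] := (derivable_wf eqa, derivable_wf eqb).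
apply: (derivable_trans (t := And a' b)).
  by apply: (derivable_maj (s1 := [::])) => //; apply: wf_And.
by apply: (derivable_maj (s1 := [:: a'])) => //; apply: wf_And.
Qed.

Lemma Or_congr a a' b b' :
  a =[n]= a' -> b =[n]= b' -> Or a b =[n]= Or a' b'.
Proof.
move=> eqa eqb; have [[wfa wfa'] [wfb wfb']] := (derivable_wf eqa, derivable_wf eqb).
apply: (derivable_trans (t := Or a' b)).
  by apply: (derivable_maj (s1 := [::])) => //; apply: wf_Or.
by apply: (derivable_maj (s1 := [:: a'])) => //; apply: wf_Or.
Qed.

Lemma AndC a b : wf n a -> wf n b -> And a b =[n]= And b a.
Proof.
move=> wfa wfb; apply: derivable_perm; last exact: wf_And.
by apply/permP=> q /=; lia.
Qed.

Lemma And1 a : wf n a -> And a One =[n]= a.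
Proof. by move=> wfa; apply: derivable_cancel3r => //; apply: Or44. Qed.

Lemma Or0 a : wf n a -> Or Zero a =[n]= a.
Proof. by move=> wfa; apply: derivable_cancel3m => //; apply: Or43. Qed.

Lemma AndN a : wf n a -> And a (Neg a) =[n]= Zero.
Proof. by move=> wfa; apply: derivable_cancel3 => //; apply: Or41. Qed.

Lemma OrN a : wf n a -> Or a (Neg a) =[n]= One.
Proof. by move=> wfa; apply: derivable_cancel3 => //; apply: Or41. Qed.

Lemma derivable_const bs :
    odd (size bs) -> size bs <= n ->
  Maj (map const_term bs)
    =[n]= const_term (uphalf (size bs) <= count id bs).
Proof.
move=> odd_bs le_n.
have wf_bs : wf n (Maj (map const_term bs)).
  by rewrite /= size_map odd_bs le_n; apply/allP=> x /mapP[[] _ ->].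
apply: derivable_trans (derivable_sym (derivable_fill wf_bs)) _.
apply: derivable_axiom; [|exact: wf_fill|by case: leqP].
apply: Omega_majority; first exact: size_fill.
have cntP (b : bool) :
    count_mem (const_term b) (map const_term bs) = count (pred1 b) bs.
  by rewrite count_map; apply: eq_count => -[] /=; case: b.
have cnt_pairs b j : count_mem (const_term b) (flatten (nseq j [:: Zero; One])) = j.
  by rewrite count_flatten map_nseq sumn_nseq; case: b => /=; lia.
(* Padding by [j] pairs raises the threshold and the counts of both constants by [j], so the
   majority bit is unchanged. *)
rewrite count_cat cnt_pairs size_map cntP.
case: (leqP (uphalf (size bs))) => maj.
  by rewrite (eq_count (a2 := id)); [lia | case].
rewrite (eq_count (a2 := predC id)); last by case.
by have := count_predC id bs; lia.
Qed.

Lemma And0 a : wf n a -> And a Zero =[n]= Zero.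
Proof.
move=> wfa; have wf0 : wf n (And a Zero) by apply: wf_And.
apply: derivable_trans (derivable_sym (derivable_fill wf0)) _.
apply: derivable_axiom => //; last exact: wf_fill.
apply: Omega_majority; first exact: size_fill.
(* Two zeros and one from each of the [(n - 3)./2] pairs make exactly [uphalf n]. *)
rewrite count_cat count_flatten map_nseq sumn_nseq /=.
by lia.
Qed.

(* The distributivity axiom, at the tuple of first arguments
   a, 0 and (n - 3) / 2 pairs 0, 1, for which M_n is conjunction with a. *)
Lemma And_Maj a l r :
    wf n a -> all (wf n) (l ++ r) -> size (l ++ r) = n ->
    uphalf n <= size l <= n.-1 ->
  And a (Maj (l ++ r)) =[n]= Maj (map (And a) l ++ r).
Proof.
move=> wfa wf_lr sz_lr sz_l.
pose pairs := flatten (nseq (n - 3)./2 [:: Zero; One]).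
pose xs := [:: a, Zero & pairs].
have fillE b : fill [:: a; b; Zero] = [:: a, b, Zero & pairs] by [].
have perm_xs b : perm_eq (fill [:: a; b; Zero]) (rcons xs b).
  by rewrite fillE; apply/permP=> q; rewrite -cats1 count_cat /=; lia.
have And_xs b : wf n b -> And a b =[n]= Maj (rcons xs b).
  move=> wfb; have wf_ab := wf_And wfa wfb.
  apply: derivable_trans (derivable_sym (derivable_fill wf_ab)) _.
  by apply: derivable_perm => //; apply: wf_fill.
have wf_M : wf n (Maj (l ++ r)) by rewrite /= sz_lr n_odd leqnn.
have sz_xs : (size xs).+1 = n.
  by have := size_fill (wf_And wfa wf_M); rewrite (perm_size (perm_xs _)) size_rcons.
apply: derivable_trans (And_xs _ wf_M) _.
have wf_xs b : wf n b -> wf n (Maj (rcons xs b)).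
  by case/And_xs/derivable_wf.
have wf_D : wf n (Maj ([seq Maj (rcons xs y) | y <- l] ++ r)).
  rewrite /= size_cat size_map -size_cat sz_lr n_odd leqnn all_cat.
  move: wf_lr; rewrite all_cat => /andP[/allP wf_l ->] /=.
  by rewrite andbT all_map; apply/allP=> x /wf_l; apply: wf_xs.
apply: derivable_trans (_ : _ =[n]= Maj ([seq Maj (rcons xs y) | y <- l] ++ r)) _.
  apply: derivable_axiom; [|exact: wf_xs|exact: wf_D].
  have := Omega_distributivity sz_l sz_xs sz_lr.
  by rewrite take_size_cat // drop_size_cat.
apply: (derivable_map (s1 := [::])) => // x l_x.
apply/derivable_sym/And_xs; apply: (allP wf_lr); by rewrite mem_cat l_x.
Qed.

Lemma Maj_majority y s :
    size s = n -> all (wf n) s -> uphalf n <= count_mem y s ->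
  Maj s =[n]= y.
Proof.
move=> sz_s wf_s maj; apply: derivable_axiom; first exact: Omega_majority.
  by rewrite /= sz_s n_odd leqnn.
by apply: (allP wf_s); rewrite -has_pred1 has_count; lia.
Qed.

(** * Lattice laws and congruence from distributivity *)

(** The number of pairs padding a ternary majority; thus [uphalf n = p.+2]. *)
Let p := (n - 3)./2.
Let nE : n = p.*2.+3. Proof. rewrite /p; lia. Qed.

(** Write [Or b c] at arity [n] with the [p.+1] ones last. Distributing over the first [p.+2]
    arguments, the least number allowed, leaves the ones untouched, and the zeros stay zeros by
    [And0]. *)
Lemma AndDr a b c : wf n a -> wf n b -> wf n c ->
  And a (Or b c) =[n]= Or (And a b) (And a c).
Proof.
move=> wfa wfb wfc.
have perm_Or x y : perm_eq (fill [:: x; y; One])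
    ([:: x, y & nseq p Zero] ++ nseq p.+1 One).
  apply/permP=> q; rewrite /fill /= -/p !count_cat !count_nseq /=.
  rewrite count_flatten map_nseq sumn_nseq /= ?count_nseq; lia.
have Or_full x y : wf n x -> wf n y ->
    Or x y =[n]= Maj ([:: x, y & nseq p Zero] ++ nseq p.+1 One).
  move=> wfx wfy; have wfxy := wf_Or wfx wfy.
  apply: derivable_trans (derivable_sym (derivable_fill wfxy)) _.
  by apply: derivable_perm => //; apply: wf_fill.
apply: derivable_trans (And_congr (derivable_refl _ wfa) (Or_full _ _ wfb wfc)) _.
have wf_bc : all (wf n) ([:: b, c & nseq p Zero] ++ nseq p.+1 One).
  by rewrite all_cat /= wfb wfc !all_nseq !orbT.
apply: derivable_trans.
  apply: And_Maj => //.
    by rewrite size_cat /= !size_nseq; lia.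
  by rewrite /= size_nseq; lia.
apply: derivable_trans; last first.
  by apply: derivable_sym; apply: Or_full; apply: wf_And.
rewrite /= map_nseq.
(* Constant maps over [p] copies of [tt] rewrite all [p] occurrences of [And a Zero] at once. *)
have := @derivable_map n _ (fun=> And a Zero) (fun=> Zero) [:: And a b; And a c]
  (nseq p tt) (nseq p.+1 One).
rewrite !map_nseq; apply=> [_ _|]; first exact: And0.
rewrite /= !size_cat !all_cat /= !size_nseq !all_nseq /= n_ge3 wfa wfb wfc !orbT.
by rewrite /= andbT; apply/andP; split; lia.
Qed.

(* Distribute in a /\ M_n(1, ..., 1, 0, ..., 0, a), with as many 1s as 0s and
   the last argument left out, so that a becomes the majority. *)
Lemma Andxx a : wf n a -> And a a =[n]= a.
Proof.
move=> wfa.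
pose cs := nseq p.+1 One ++ nseq p.+1 Zero.
have wf_cs x : wf n x -> wf n (Maj (cs ++ [:: x])).
  move=> wfx; apply: wf_full; first by rewrite !size_cat !size_nseq /=; lia.
  by rewrite !all_cat !all_nseq !orbT /= wfx.
have xE : Maj (cs ++ [:: a]) =[n]= a.
  apply: derivable_trans (_ : _ =[n]= Maj (fill [:: a])) _.
    apply: derivable_perm; last exact: wf_cs.
    apply/permP=> q; rewrite /fill /= !count_cat !count_nseq /=.
    rewrite count_flatten map_nseq sumn_nseq (_ : (n - 1)./2 = p.+1) /=; last lia.
    by rewrite count_nseq; lia.
  apply: derivable_trans (derivable_fill _) _; first by rewrite /= wfa; lia.
  by apply: derivable_unary => //; lia.
apply: derivable_trans (And_congr (derivable_refl _ wfa) (derivable_sym xE)) _.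
apply: derivable_trans.
  apply: And_Maj => //; first by have /and3P[] := wf_cs a wfa.
    by rewrite !size_cat !size_nseq /=; lia.
  by rewrite !size_cat !size_nseq /=; lia.
pose ds := nseq p.+1 a ++ nseq p.+1 Zero ++ [:: a].
have wf_ds : all (wf n) ds by rewrite !all_cat !all_nseq /= wfa ?orbT.
have maj_ds : Maj ds =[n]= a.
  apply: Maj_majority => //; first by rewrite !size_cat !size_nseq /=; lia.
  by rewrite !count_cat !count_nseq /= eqxx; lia.
apply: derivable_trans maj_ds.
pose G x := if x == One then a else Zero.
have -> : ds = map G cs ++ [:: a] by rewrite map_cat !map_nseq -catA.
apply: (@derivable_map n _ (And a) G [::] cs [:: a]) => [x|].
  by rewrite mem_cat => /orP[] /nseqP[-> _]; [exact: And1 | exact: And0].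
apply: wf_full; first by rewrite !size_cat size_map size_cat !size_nseq /=; lia.
rewrite cat0s all_cat map_cat !map_nseq all_cat !all_nseq !wf_And ?orbT //=.
by rewrite wfa.
Qed.

(* And_Maj may leave out any argument, here one other than y; this turns y
   into And a y without disturbing the rest. *)
Lemma And_Maj_congr a s1 s2 y z :
    wf n a -> And a y =[n]= And a z -> wf n y -> wf n z ->
    wf n (Maj (s1 ++ y :: s2)) ->
  And a (Maj (s1 ++ y :: s2)) =[n]= And a (Maj (s1 ++ z :: s2)).
Proof.
move=> wfa eq_yz wfy wfz wf_s.
pose rest := s1 ++ s2 ++ flatten (nseq (n - size (s1 ++ y :: s2))./2 [:: Zero; One]).
have perm_rest x : perm_eq (fill (s1 ++ x :: s2)) (x :: rest).
  apply/permP=> q; rewrite /fill /rest !size_cat /= !count_cat /= ?count_cat; lia.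
have wf_rest : all (wf n) rest.
  have /and3P[_ _] := wf_fill wf_s.
  by rewrite (perm_all _ (perm_rest y)) => /andP[].
have sz_rest : (size rest).+1 = n.
  by rewrite -(size_fill wf_s) (perm_size (perm_rest y)).
(* Since [n >= 3], there is an argument [w] besides [y] to leave out; the other [n.-1] receive the
   conjunct. *)
case/lastP E: rest wf_rest sz_rest perm_rest => [|u w]; first by rewrite /=; lia.
rewrite all_rcons size_rcons => /andP[wfw wfu] sz_u perm_u {rest E}.
have AndE x : wf n x -> wf n (Maj (s1 ++ x :: s2)) ->
    And a (Maj (s1 ++ x :: s2)) =[n]= Maj (And a x :: map (And a) u ++ [:: w]).
  move=> wfx wf_sx; apply: (derivable_trans (t := And a (Maj ((x :: u) ++ [:: w])))).
    apply: And_congr; first exact: derivable_refl.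
    apply: derivable_trans (derivable_sym (derivable_fill wf_sx)) _.
    by apply: derivable_perm; [rewrite cats1; apply: perm_u | apply: wf_fill].
  apply: (@And_Maj a (x :: u)) => //.
  - by rewrite all_cat /= wfx wfu wfw.
  - by rewrite size_cat /=; lia.
  - by rewrite /=; lia.
have wf_sz : wf n (Maj (s1 ++ z :: s2)).
  by move: wf_s; rewrite /= !size_cat !all_cat /= wfy wfz.
apply: derivable_trans (AndE y wfy wf_s) _.
apply: derivable_trans (derivable_sym (AndE z wfz wf_sz)).
apply: (derivable_maj (s1 := [::])) => //.
by have [] := derivable_wf (AndE y wfy wf_s).
Qed.

(** * Substitution and case distinction under a conjunct *)

(** By De Morgan and distributivity the left side is [(a /\ ~ a) \/ (a /\ ~ u)], whose first
    disjunct vanishes. *)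
Lemma And_Neg_And a u : wf n a -> wf n u ->
  And a (Neg (And a u)) =[n]= And a (Neg u).
Proof.
move=> wfa wfu.
have deMorgan : Neg (And a u) =[n]= Or (Neg a) (Neg u).
  apply: derivable_trans (derivable_inverter (wf_And wfa wfu)) _.
  apply: (derivable_maj (s1 := [:: Neg a; Neg u])); last exact: derivable_Neg0.
  by rewrite /= n_ge3 wfa wfu.
apply: derivable_trans (And_congr (derivable_refl _ wfa) deMorgan) _.
apply: derivable_trans (AndDr (b := Neg a) (c := Neg u) wfa wfa wfu) _.
have wfaNu : wf n (And a (Neg u)) by apply: wf_And.
apply: derivable_trans (Or0 wfaNu).
apply: Or_congr; first exact: AndN.
exact: derivable_refl.
Qed.

Lemma And_subst a sigma tau t :
    wf n a -> wf n t ->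
    (forall i, wf n (sigma i)) -> (forall i, wf n (tau i)) ->
    (forall i, And a (sigma i) =[n]= And a (tau i)) ->
  And a (subst sigma t) =[n]= And a (subst tau t).
Proof.
move=> wfa wft wf_sigma wf_tau eq_st.
have refl x : wf n x -> And a x =[n]= And a x.
  by move=> wfx; apply: derivable_refl; apply: wf_And.
have reflD x : wf n x -> x =[n]= x by apply: derivable_refl.
elim/term_nested_ind: t wft => //=.
- by move=> _; apply: refl.
- by move=> _; apply: refl.
- move=> t IHt wft; have wfs rho := @wf_subst n rho t ^~ wft.
  (* Inserting [a] under the negation makes the induction hypothesis applicable there. *)
  apply: derivable_trans (derivable_sym (And_Neg_And wfa (wfs _ wf_sigma))) _.
  apply: derivable_trans (And_Neg_And wfa (wfs _ wf_tau)).
  apply: And_congr; first exact: reflD.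
  exact/derivable_neg/IHt.
move=> ts IHts wf_ts; have wf_ts' := wf_subst (t := Maj ts) wf_sigma wf_ts.
case/and3P: wf_ts => _ _; move: wf_ts' IHts => /=.
(* The empty prefix is generalized to the list [s1] of arguments already switched to [tau]. *)
rewrite -[map (subst sigma) ts]cat0s -[map (subst tau) ts]cat0s.
rewrite -/(wf n (Maj _)); elim: ts [::] => [|t ts IH] s1 wf_s /=.
  by move=> _ _; apply: refl.
move=> [IHt IHts] /andP[wft wf_ts].
have wf_s' : wf n (Maj (s1 ++ subst tau t :: map (subst sigma) ts)).
  move: wf_s; rewrite /= !size_cat !all_cat /= => /and3P[-> -> /and3P[-> _ ->]].
  by rewrite wf_subst.
apply: (derivable_trans (t := And a (Maj (s1 ++ subst tau t :: map (subst sigma) ts)))).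
  by apply: And_Maj_congr => //; [exact: IHt | apply: wf_subst | apply: wf_subst].
by rewrite -!(cat_rcons (subst tau t)) in wf_s' *; apply: IH.
Qed.

(** Each side is recovered from its two halves by expanding [u = u /\ (x \/ ~ x)]. *)
Lemma derivable_cases x s t :
    wf n x -> wf n s -> wf n t ->
    And x s =[n]= And x t -> And (Neg x) s =[n]= And (Neg x) t ->
  s =[n]= t.
Proof.
move=> wfx wfs wft eq1 eq0.
have expand u : wf n u -> u =[n]= Or (And x u) (And (Neg x) u).
  move=> wfu; apply: derivable_trans (derivable_sym (And1 wfu)) _.
  apply: derivable_trans (_ : _ =[n]= And u (Or x (Neg x))) _.
    by apply: And_congr; [exact: derivable_refl | apply/derivable_sym/OrN].
  apply: derivable_trans (AndDr (c := Neg x) wfu wfx wfx) _.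
  by apply: Or_congr; apply: AndC.
apply: derivable_trans (expand s wfs) _.
apply: derivable_trans (derivable_sym (expand t wft)).
exact: Or_congr.
Qed.

End Algebra.

(** * Elimination of variables *)

(** Interpolates between the closed instance under [v], at [N = 0], and the identity on any given
    term, for large [N]. *)
Definition partial_assignment (N : nat) (v : nat -> bool) (i : nat) :=
  if i < N then Var i else const_term (v i).

Lemma wf_partial_assignment n N v i : wf n (partial_assignment N v i).
Proof. by rewrite /partial_assignment; case: ifP => //; case: (v i). Qed.

Lemma subst_partial_assignment t : exists N, forall M v,
  N <= M -> subst (partial_assignment M v) t = t.
Proof.
elim/term_nested_ind: t => [i||||s].
- by exists i.+1 => M v lt_iM; rewrite /= /partial_assignment lt_iM.
- by exists 0.
- by exists 0.
- by move=> t [N tN]; exists N => M v /tN /= ->.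
move=> IHs; suff [N sN] : exists N, forall M v, N <= M ->
    map (subst (partial_assignment M v)) s = s.
  by exists N => M v /sN /= ->.
elim: s IHs => [|t s IHs] /=; first by exists 0.
case=> -[N1 tN] /IHs[N2 sN]; exists (maxn N1 N2) => M v.
by rewrite geq_max => /andP[/tN-> /sN->].
Qed.

Lemma derivable_eval n t v : 3 <= n -> odd n -> wf n t ->
  subst (const_term \o v) t =[n]= const_term (eval v t).
Proof.
move=> n_ge3 n_odd; elim/term_nested_ind: t => //=.
- by move=> i _; apply: derivable_refl; case: (v i).
- by move=> _; apply: derivable_refl.
- by move=> _; apply: derivable_refl.
- move=> t IHt /IHt /derivable_neg Et; apply: derivable_trans Et _.
  by case: (eval v t); [exact: derivable_Neg1 | exact: derivable_Neg0].
move=> s IHs /and3P[odd_s le_n wf_s].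
have := @derivable_const n n_ge3 n_odd (map (eval v) s).
rewrite size_map count_map -map_comp => /(_ odd_s le_n); apply: derivable_trans.
have {}IHs : {in s, forall t, subst (const_term \o v) t =[n]= const_term (eval v t)}.
  elim: s IHs wf_s {odd_s le_n} => //= t s IH [IHt IHs] /andP[wft wfs] u.
  by rewrite inE => /predU1P[->|/(IH IHs wfs)//]; apply: IHt.
have := @derivable_map n _ _ _ [::] s [::] IHs.
rewrite /= !cats0 size_map odd_s le_n; apply.
by rewrite all_map; apply/allP=> t /IHs/derivable_wf[].
Qed.

Theorem theorem2 (n : nat) (n_ge3 : 3 <= n) (n_odd : odd n) (s t : term)
    (s_wf : wf n s) (t_wf : wf n t)
    (valid : forall v : nat -> bool, eval v s = eval v t) :
  derivable n (Omega n) s t.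
Proof.
have [[N1 sN1] [N2 tN2]] := (subst_partial_assignment s, subst_partial_assignment t).
(* Any assignment would do: at the bound [maxn N1 N2] no variable of [s] or [t] is replaced. *)
pose v0 i := i == 0.
rewrite -(sN1 (maxn N1 N2) v0) ?leq_maxl // -(tN2 (maxn N1 N2) v0) ?leq_maxr //.
elim: (maxn N1 N2) v0 => [|N IHN] v.
  (* [partial_assignment 0 v] is convertible to [const_term \o v]. *)
  have Es := derivable_eval v n_ge3 n_odd s_wf.
  apply: derivable_trans Es _; rewrite valid.
  exact/derivable_sym/derivable_eval.
have wfP M w i := wf_partial_assignment n M w i.
have wfS M w := wf_subst (wfP M w).
have refl x : wf n x -> derivable n (Omega n) x x by apply: derivable_refl.
pose fix_last b i := if i == N then b else v i.
have fixP x b u : wf n x -> wf n u ->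
    And x (Var N) =[n]= And x (const_term b) ->
  And x (subst (partial_assignment N.+1 v) u) =[n]=
  And x (subst (partial_assignment N (fix_last b)) u).
  move=> wfx wfu xN; apply: And_subst => // i; rewrite /partial_assignment /fix_last ltnS.
  (* The two substitutions differ only at [i = N], where [xN] applies. *)
  by case: ltngtP => [||->] // _; apply: refl; apply: wf_And => //; case: (v i).
have step x b : wf n x -> And x (Var N) =[n]= And x (const_term b) ->
  And x (subst (partial_assignment N.+1 v) s) =[n]=
  And x (subst (partial_assignment N.+1 v) t).
  move=> wfx xN; apply: derivable_trans (fixP x b s wfx s_wf xN) _.
  apply: derivable_trans (derivable_sym (fixP x b t wfx t_wf xN)).
  by apply: And_congr => //; apply: refl.
apply: (@derivable_cases _ n_ge3 n_odd (Var N)) => //; try exact: wfS.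
  (* Below [x], the variable is 1: [x /\ x = x = x /\ 1]. *)
  apply: (step _ true) => //; apply: derivable_trans (Andxx n_ge3 n_odd _) _ => //.
  exact/derivable_sym/And1.
have wfN : wf n (Neg (Var N)) by [].
have wfV : wf n (Var N) by [].
(* Below [~ x] it is 0: [~ x /\ x = 0 = ~ x /\ 0]. *)
apply: (step _ false) => //; apply: derivable_trans (AndC n_ge3 n_odd wfN wfV) _.
apply: derivable_trans (AndN n_ge3 n_odd wfV) _; exact/derivable_sym/And0.
Qed.
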